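(* Let $n\ge 2$ and $\mathbf{x}\in\mathbb{R}^n$, and let $\mathbf{B}_{\mathbf{x}}=\mathbf{C}_{\mathbf{x}}^\top\mathbf{C}_{\mathbf{x}}$. Then the following are equivalent: (i) $\mathbf{x}\in\mathcal{C}_n'$; (ii) there exists $m\in\mathbb{N}$ such that $\mathbf{B}_{\mathbf{x}}^m>\mathbf{0}$; (iii) there exists $m_0\in\mathbb{N}$ such that for all $m\ge m_0$: $\mathbf{B}_{\mathbf{x}}^m>\mathbf{0}$.
   Context: $\mathbb{N}=\{1,2,3,\dots\}$. For $\mathbf{x}=(x_0,\dots,x_{n-1})\in\mathbb{R}^n$, $\mathbf{C}_{\mathbf{x}}\in\mathbb{R}^{n\times n}$ is the circulant matrix with first row $(x_0,x_1,\dots,x_{n-1})$, each further row being the cyclic shift to the right by one position of the row above; i.e. the entry in row $j$, column $k$ ($0\le j,k\le n-1$) is $x_{(k-j)\bmod n}$. For a matrix $\mathbf{M}$, $\mathbf{M}>\mathbf{0}$ means that every entry of $\mathbf{M}$ is positive. $\|\cdot\|$ denotes the spectral norm of a matrix (the matrix norm induced by the Euclidean norm). Let $c(t)=x_0+x_1t+\dots+x_{n-1}t^{n-1}$ and $\mathbb{T}_n=\{t\in\mathbb{C}:t^n=1\}$. Define $\mathcal{C}_n=\{\mathbf{x}\in\mathbb{R}^n:\ \|\mathbf{C}_{\mathbf{x}}\|=|x_0+x_1+\dots+x_{n-1}|\}$ and, for $n\ge2$, $\mathcal{C}_n'=\{\mathbf{x}\in\mathcal{C}_n:\ \max_{t\in\mathbb{T}_n\setminus\{1\}}|c(t)|<|c(1)|\}$.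 *)

(* Defs.v *)
From HB Require Import structures.
From mathcomp Require Import all_boot all_order all_algebra.
From mathcomp Require Import complex.
From mathcomp Require Import boolp classical_sets reals.

Set Implicit Arguments.
Unset Strict Implicit.
Unset Printing Implicit Defensive.

Import Order.TTheory GRing.Theory Num.Theory.

Local Open Scope classical_set_scope.
Local Open Scope ring_scope.

Lemma ord_diff_subproof (n : nat) (j k : 'I_n) : ((k + (n - j)) %% n < n)%N.
Proof. by rewrite ltn_pmod // (leq_ltn_trans _ (ltn_ord j)). Qed.

(* (k - j) mod n, written k + (n - j) because subtraction on nat truncates. *)
Definition ord_diff (n : nat) (k j : 'I_n) : 'I_n :=
  Ordinal (ord_diff_subproof j k).

Definition circulant (R : realType) (n : nat) (x : 'rV[R]_n) : 'M[R]_n :=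
  \matrix_(j < n, k < n) x 0 (ord_diff k j).

Definition mx_pos (R : realType) (m n : nat) (M : 'M[R]_(m, n)) : Prop :=
  forall i j, 0 < M i j.

Definition enorm (R : realType) (n : nat) (v : 'cV[R]_n) : R :=
  Num.sqrt (\sum_(i < n) v i 0 ^+ 2).

(* The library norm on matrices (and vectors) is the entrywise maximum, hence
   the explicit enorm and induced norm. *)
Definition spectral_norm (R : realType) (m n : nat) (M : 'M[R]_(m, n)) : R :=
  sup [set enorm (M *m v) | v in [set v : 'cV[R]_n | enorm v = 1]].

Definition symbol (R : realType) (n : nat) (x : 'rV[R]_n) (t : R[i]) : R[i] :=
  \sum_(i < n) (x 0 i)%:C%C * t ^+ i.

Definition unity_roots (R : realType) (n : nat) : set R[i] :=
  [set t : R[i] | t ^+ n = 1].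

Definition Cset (R : realType) (n : nat) : set 'rV[R]_n :=
  [set x : 'rV[R]_n | spectral_norm (circulant x) = `|\sum_(i < n) x 0 i|].

(* For 2 <= n the set under sup is finite and nonempty, so sup is the maximum;
   normc is the complex modulus with values in R rather than R[i]. *)
Definition Cset' (R : realType) (n : nat) : set 'rV[R]_n :=
  [set x : 'rV[R]_n | Cset x /\
    sup [set ComplexField.Normc.normc (symbol x t) | t in @unity_roots R n `\ (1 : R[i])]
      < ComplexField.Normc.normc (symbol x 1)].

(* Main.v *)
Require Import Defs.
From mathcomp Require Import all_boot all_order all_algebra.
From mathcomp Require Import cyclic separable cyclotomic.
From mathcomp Require Import complex.
From mathcomp Require Import boolp classical_sets reals.
From mathcomp Require Import topology normedtype sequences.

Import Order.TTheory GRing.Theory Num.Theory.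
Import numFieldNormedType.Exports.
Local Open Scope ring_scope.

(** The vectors [F_t = (1, t, ..., t^(n-1))], where [t] runs over the n-th roots
    of unity, diagonalize every circulant matrix: [C_x F_t = c(t) F_t] and
    [C_x^T F_t = c(1/t) F_t], where [c(1/t)] is the conjugate of [c(t)] because
    [x] is real. Hence [B^m F_t = |c(t)|^(2m) F_t] for every [m], and all three
    conditions are read off these eigenvalues. The link between them is the
    strict dominance of the trivial character: [|c(t)| < |c(1)|] for all roots of
    unity [t <> 1].

    If [B^m > 0] for a single [m], then a row of [B^m F_t] is a positive
    combination of the powers of [t], whose modulus is strictly less than its
    value at [t = 1] (lemma [norm_sum_unity_root_lt]), which gives dominance
    ([dominant_gram_exp_pos]).

    Conversely, Fourier inversion writes the entries of [B^m] as
    [n (B^m)_jk = |c(1)|^(2m) + sum over t <> 1 of |c(t)|^(2m) t^(j-k)].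
    Under dominance the first term outgrows the others geometrically, so the
    entries are positive for all large [m] ([gram_exp_pos]).

    Finally, membership in [Cset'] is dominance together with a condition on the
    spectral norm, and dominance already implies that condition
    ([spectral_norm_circulant]): by Parseval, [|C_x v| <= |c(1)| |v|], with
    equality on constant vectors, so the spectral norm is [|c(1)|], the modulus of
    the sum of the entries of [x]. *)

(** * Roots of unity *)

Lemma exists_primitive_root (F : numClosedFieldType) (n : nat) :
  (0 < n)%N -> exists z : F, n.-primitive_root z.
Proof.
move=> n_gt0; pose p : {poly F} := 'X^n - 1.
have [r Dp] := closed_field_poly_normal p.
rewrite (monicP _) ?monicXnsubC // scale1r in Dp.
have rn1 : all n.-unity_root r by apply/allP=> z; rewrite -root_prod_XsubC -Dp.
have sz_r : (n < (size r).+1)%N.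
  by rewrite -(size_prod_XsubC r id) -Dp size_XnsubC.
have r_uniq : uniq r.
  by rewrite -separable_prod_XsubC -Dp separable_Xn_sub_1 // pnatr_eq0 -lt0n.
by have /hasP[z _ pz] := has_prim_root n_gt0 rn1 r_uniq sz_r; exists z.
Qed.

Lemma norm_unity_root (F : numDomainType) (n : nat) (t : F) :
  (0 < n)%N -> t ^+ n = 1 -> `|t| = 1.
Proof.
by move=> n_gt0 tn1; apply/eqP; rewrite -(pexpr_eq1 n_gt0) // -normrX tn1 normr1.
Qed.

Lemma unity_root_unit (F : unitRingType) (n : nat) (t : F) :
  (0 < n)%N -> t ^+ n = 1 -> t \is a GRing.unit.
Proof. by move=> n_gt0 tn1; rewrite -(unitrX_pos _ n_gt0) tn1 unitr1. Qed.

Lemma conj_unity_root (F : numClosedFieldType) (n : nat) (t : F) :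
  (0 < n)%N -> t ^+ n = 1 -> t^* = t^-1.
Proof.
move=> n_gt0 tn1; rewrite invC_norm (norm_unity_root _ _ _ n_gt0 tn1).
by rewrite expr1n invr1 mul1r.
Qed.

(** The characters of Z/n are orthogonal: for [a <> b] the ratio
    [w = z ^ (a - b)] is an n-th root of unity other than 1, so the geometric
    sum of its powers is annihilated by [w - 1]. *)
Lemma sum_primitive_root (F : fieldType) (n : nat) (z : F) (a b : 'I_n) :
  n.-primitive_root z ->
  \sum_(l < n) (z ^+ l) ^+ a * (z ^+ l) ^- b = n%:R *+ (a == b).
Proof.
move=> pz; have n_gt0 := prim_order_gt0 pz.
have zn1 := prim_expr_order pz; have zU := unity_root_unit _ _ _ n_gt0 zn1.
pose w := z ^+ a * z ^- b.
have -> : \sum_(l < n) (z ^+ l) ^+ a * (z ^+ l) ^- b = \sum_(l < n) w ^+ l.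
  by apply: eq_bigr => l _; rewrite exprMn exprVn -!exprM ![(l * _)%N]mulnC.
have wn1 : w ^+ n = 1.
  by rewrite exprMn exprVn -!exprM ![(_ * n)%N]mulnC !exprM zn1 !expr1n invr1 mulr1.
case: eqVneq => [eq_ab | neq_ab].
  have -> : w = 1 by rewrite /w eq_ab divrr // unitrX.
  by under eq_bigr do rewrite expr1n; rewrite sumr_const card_ord mulr1n.
have w_neq1 : w != 1.
  apply: contra neq_ab => /eqP w1.
  have : z ^+ a == z ^+ b by rewrite -[z ^+ b]mul1r -w1 divrK // unitrX.
  by rewrite (eq_prim_root_expr pz) !modn_small.
apply/eqP; rewrite mulr0n -(mulrI_eq0 _ (@mulfI _ (w - 1) _)) ?subr_eq0 //.
by rewrite -subrX1 wn1 subrr.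
Qed.

Lemma prim_root_unity (F : nzRingType) (n : nat) (z : F) (l : nat) :
  n.-primitive_root z -> (z ^+ l) ^+ n = 1.
Proof. by move=> pz; rewrite exprAC (prim_expr_order pz) expr1n. Qed.

(** * Two estimates *)

Lemma pow_dominates (R : realType) (a b N : R) : 0 <= b -> b < a ->
  exists m0, forall m, (m0 <= m)%N -> N * b ^+ m < a ^+ m.
Proof.
move=> b_ge0 lt_ba; have a_gt0 := le_lt_trans b_ge0 lt_ba.
pose q := b / a.
have q_lt1 : `|q| < 1.
  by rewrite ger0_norm ?divr_ge0 ?(ltW a_gt0) // ltr_pdivrMr // mul1r.
have N1_gt0 : 0 < `|N| + 1 by rewrite ltr_wpDl.
have invN1_gt0 : 0 < (`|N| + 1)^-1 by rewrite invr_gt0.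
have /cvgrPdist_lt qcvg := cvg_expr q_lt1.
have [m0 _ small] := qcvg _ invN1_gt0.
exists m0 => m /small /=; rewrite sub0r normrN normrX => qm_lt.
have q_ge0 : 0 <= q by rewrite divr_ge0 ?(ltW a_gt0).
rewrite (ger0_norm q_ge0) in qm_lt.
have -> : b ^+ m = q ^+ m * a ^+ m.
  by rewrite -exprMn /q divrK // unitfE gt_eqF.
rewrite mulrA -[ltRHS]mul1r ltr_pM2r ?exprn_gt0 //.
apply: le_lt_trans (_ : (`|N| + 1) * q ^+ m < 1).
  apply: ler_wpM2r; first exact: exprn_ge0.
  by rewrite (le_trans (ler_norm N)) // lerDl.
by rewrite mulrC -ltr_pdivlMr // div1r.
Qed.

(** Strict triangle inequality: equality would force all the terms [p i * t ^+ i] to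
    have the same argument, in particular the terms of index 0 and 1, so [t] would
    be a positive number of modulus 1. *)
Lemma norm_sum_unity_root_lt (F : numClosedFieldType) (n : nat) (p : 'I_n -> F)
    (t : F) : (2 <= n)%N -> (forall i, 0 < p i) -> `|t| = 1 -> t != 1 ->
  `|\sum_(i < n) p i * t ^+ i| < \sum_(i < n) p i.
Proof.
move=> n_ge2 p_gt0 t1 t_neq1.
have normp i : `|p i * t ^+ i| = p i.
  by rewrite normrM normrX t1 expr1n mulr1 gtr0_norm.
have normS : \sum_(i < n) `|p i * t ^+ i| = \sum_(i < n) p i.
  by apply: eq_bigr => i _.
rewrite lt_neqAle -normS ler_norm_sum andbT; apply: contra t_neq1 => /eqP.
case/normC_sum_eq => u _ pE.
have uE (i : 'I_n) : t ^+ i = u.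
  have pi_neq0 : p i != 0 by rewrite gt_eqF.
  by apply: (mulfI pi_neq0); rewrite (pE i isT) normp.
have u1 : u = 1 by rewrite -(uE (Ordinal (ltnW n_ge2))) expr0.
by rewrite -[t]expr1 (uE (Ordinal n_ge2)) u1.
Qed.

(** * Fourier analysis of circulant matrices *)

Section Circulant.

Variables (R : realType) (n : nat).
Hypothesis n_gt0 : (0 < n)%N.

Local Notation C := R[i].
Local Notation toC := (real_complex R).
Local Notation cmx := (map_mx toC).
Local Notation normc := ComplexField.Normc.normc.

Implicit Types (x y : 'rV[R]_n) (t z : C).

Lemma norm_normc t : `|t| = (normc t)%:C%C.
Proof. by rewrite normc_def /normc; case: t. Qed.

Lemma normc_ge0 t : 0 <= normc t.
Proof. by case: t => a b; exact: sqrtr_ge0. Qed.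

Definition fourier t : 'cV[C]_n := \col_(k < n) t ^+ k.

Lemma symbolE y t : symbol y t = (cmx y *m fourier t) 0 0.
Proof. by rewrite mxE; apply: eq_bigr => i _; rewrite !mxE. Qed.

Lemma symbol1 y : symbol y 1 = (\sum_(i < n) y 0 i)%:C%C.
Proof.
by rewrite rmorph_sum; apply: eq_bigr => i _; rewrite expr1n mulr1.
Qed.

Lemma conj_toC (r : R) : (toC r)^* = toC r.
Proof. by apply: conj_Creal; rewrite realE !lecR -realE num_real. Qed.

Lemma conj_symbol y t : t ^+ n = 1 -> (symbol y t)^* = symbol y t^-1.
Proof.
move=> tn1; rewrite rmorph_sum; apply: eq_bigr => i _.
by rewrite rmorphM rmorphXn /= conj_toC (conj_unity_root _ _ _ n_gt0 tn1).
Qed.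

Lemma norm_symbolV y t : t ^+ n = 1 -> `|symbol y t^-1| = `|symbol y t|.
Proof. by move=> tn1; rewrite -conj_symbol // norm_conjC. Qed.

Lemma expr_ord_diff t (k j : 'I_n) :
  t ^+ n = 1 -> t ^+ ord_diff k j * t ^+ j = t ^+ k.
Proof.
move=> tn1; rewrite /= expr_mod // -exprD -addnA subnK ?(ltnW (ltn_ord j)) //.
by rewrite exprD tn1 mulr1.
Qed.

Lemma ord_diff_injl (j : 'I_n) : injective (fun k : 'I_n => ord_diff k j).
Proof.
move=> k k' /(congr1 val) /= /eqP; rewrite eqn_modDr !modn_small //.
by move=> /eqP/val_inj.
Qed.

Lemma ord_diff_injr (k : 'I_n) : injective (fun j : 'I_n => ord_diff k j).
Proof.
move=> j j' /(congr1 val) /= /eqP; rewrite eqn_modDl -(eqn_modDr (j + j')).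
(* Adding [j + j'] clears the truncated subtractions [n - j] and [n - j']. *)
rewrite addnA subnK ?(ltnW (ltn_ord j)) // [(j + j')%N]addnC addnA.
rewrite subnK ?(ltnW (ltn_ord j')) // !modnDl !modn_small //.
by move=> /eqP/val_inj.
Qed.

Lemma circulant_fourier x t : t ^+ n = 1 ->
  cmx (circulant x) *m fourier t = symbol x t *: fourier t.
Proof.
move=> tn1; apply/matrixP => j i; rewrite !mxE mulr_suml.
rewrite [RHS](reindex_inj (ord_diff_injl j)); apply: eq_bigr => k _.
by rewrite !mxE -(expr_ord_diff _ _ j tn1) mulrA.
Qed.

Lemma tr_circulant_fourier x t : t ^+ n = 1 ->
  cmx (circulant x)^T *m fourier t = symbol x t^-1 *: fourier t.
Proof.
move=> tn1; apply/matrixP => k i; rewrite !mxE mulr_suml.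
rewrite [RHS](reindex_inj (ord_diff_injr k)); apply: eq_bigr => j _.
rewrite !mxE -(expr_ord_diff t k j tn1) mulrA; congr (_ * _).
by rewrite exprVn divrK // unitrX // (unity_root_unit _ n).
Qed.

Local Notation gram x := ((circulant x)^T *m circulant x).

(** The two eigenvalues [c(t)] and [c(1/t)] multiply to [|c(t)|^2] since they
    are conjugate. *)
Lemma gram_exp_fourier x t m : t ^+ n = 1 ->
  cmx (gram x ^+ m) *m fourier t = `|symbol x t| ^+ (2 * m) *: fourier t.
Proof.
move=> tn1; elim: m => [|m IHm].
  by rewrite !expr0 map_scalar_mx /= mul1mx scale1r.
rewrite exprS map_mxM -mulmxA IHm -scalemxAr map_mxM -mulmxA.
rewrite circulant_fourier // -scalemxAr tr_circulant_fourier // !scalerA.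
congr (_ *: _); by rewrite -conj_symbol // mulnS exprD normCK -mulrA mulrC.
Qed.

(** Fourier inversion: testing [M] against the characters recovers its entries, by
    orthogonality. *)
Lemma fourier_inversion (M : 'M[R]_n) (lam : C -> C) z : n.-primitive_root z ->
    (forall t, t ^+ n = 1 -> cmx M *m fourier t = lam t *: fourier t) ->
  forall j k, n%:R * (M j k)%:C%C =
    \sum_(l < n) lam (z ^+ l) * ((z ^+ l) ^+ j * (z ^+ l) ^- k).
Proof.
move=> pz M_eigen j k.
have eigenE (l : 'I_n) :
    lam (z ^+ l) * (z ^+ l) ^+ j = \sum_(i < n) (M j i)%:C%C * (z ^+ l) ^+ i.
  have /matrixP/(_ j 0) := M_eigen _ (prim_root_unity _ _ _ l pz).
  by rewrite !mxE => <-; apply: eq_bigr => i _; rewrite !mxE.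
under eq_bigr do rewrite mulrA eigenE mulr_suml.
rewrite exchange_big /= (bigD1 k) //= [X in _ + X]big1 => [|i i_neq_k].
  under eq_bigr do rewrite -mulrA.
  by rewrite -mulr_sumr sum_primitive_root // eqxx mulr1n addr0 mulrC.
under eq_bigr do rewrite -mulrA.
by rewrite -mulr_sumr sum_primitive_root // (negbTE i_neq_k) mulr0.
Qed.

(** Expanding the squared moduli and summing over the characters kills the cross
    terms [y_j y_k], [j <> k]. *)
Lemma parseval y z : n.-primitive_root z ->
  n%:R * (\sum_(j < n) y 0 j ^+ 2)%:C%C = \sum_(l < n) `|symbol y (z ^+ l)| ^+ 2.
Proof.
move=> pz.
have expand (l : 'I_n) : `|symbol y (z ^+ l)| ^+ 2 = \sum_(j < n) \sum_(k < n)
    (y 0 j * y 0 k)%:C%C * ((z ^+ l) ^+ j * (z ^+ l) ^- k).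
  have zln1 := prim_root_unity _ _ _ l pz.
  rewrite normCK conj_symbol // mulr_suml; apply: eq_bigr => j _.
  rewrite mulr_sumr; apply: eq_bigr => k _.
  by rewrite rmorphM exprVn mulrACA.
under [RHS]eq_bigr do rewrite expand.
rewrite exchange_big /= rmorph_sum mulr_sumr; apply: eq_bigr => j _.
rewrite exchange_big /= (bigD1 j) //= [X in _ + X]big1 => [|k k_neq_j].
  by rewrite -mulr_sumr sum_primitive_root // eqxx addr0 mulrC mulr1n.
by rewrite -mulr_sumr sum_primitive_root // eq_sym (negbTE k_neq_j) mulr0.
Qed.

(** Multiplication by a circulant matrix is diagonal in the Fourier basis; with
    [parseval] this reduces its operator norm to the moduli of the symbol. *)
Lemma symbol_circulant_mul x (v : 'cV[R]_n) t : t ^+ n = 1 ->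
  symbol (circulant x *m v)^T t = symbol x t^-1 * symbol v^T t.
Proof.
move=> tn1; rewrite symbolE trmx_mul map_mxM -mulmxA tr_circulant_fourier //.
by rewrite -scalemxAr mxE -symbolE.
Qed.

(** * The spectral norm *)

Lemma enorm_sqr (v : 'cV[R]_n) : enorm v ^+ 2 = \sum_(i < n) v i 0 ^+ 2.
Proof. by rewrite sqr_sqrtr // sumr_ge0 // => i _; rewrite sqr_ge0. Qed.

Lemma enormZ (a : R) (v : 'cV[R]_n) : enorm (a *: v) = `|a| * enorm v.
Proof.
rewrite /enorm -sqrtr_sqr -sqrtrM ?sqr_ge0 // mulr_sumr; congr Num.sqrt.
by apply: eq_bigr => i _; rewrite mxE exprMn.
Qed.

(** By Parseval, applied to [v] and to its image, both squared norms are averages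
    over the characters, where the image carries the extra factor
    [|c(t)|^2 <= |c(1)|^2]. *)
Lemma enorm_circulant_le x (v : 'cV[R]_n) :
  (forall t, t ^+ n = 1 -> `|symbol x t| <= `|symbol x 1|) ->
  enorm (circulant x *m v) <= `|\sum_(i < n) x 0 i| * enorm v.
Proof.
move=> le_symbol; have [z pz] := exists_primitive_root C n n_gt0.
rewrite -(@ler_pXn2r _ 2) ?nnegrE ?mulr_ge0 ?sqrtr_ge0 // exprMn.
rewrite -(@ler_pM2l _ n%:R) ?ltr0n // -lecR !enorm_sqr mulrCA.
have sumT (w : 'cV[R]_n) : \sum_(i < n) w i 0 ^+ 2 = \sum_(i < n) w^T 0 i ^+ 2.
  by apply: eq_bigr => i _; rewrite mxE.
have sE : toC (`|\sum_(i < n) x 0 i| ^+ 2) = `|symbol x 1| ^+ 2.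
  by rewrite symbol1 normCK conj_toC -rmorphM /= real_normK ?num_real.
rewrite !sumT [leLHS]rmorphM [leRHS]rmorphM /= sE rmorphM /= rmorph_nat.
rewrite !(parseval _ _ pz) mulr_sumr; apply: ler_sum => l _.
have zln1 := prim_root_unity _ _ _ l pz.
rewrite symbol_circulant_mul // normrM norm_symbolV // exprMn.
by apply: ler_wpM2r; [exact: exprn_ge0 | apply: lerXn2r; rewrite ?nnegrE ?le_symbol].
Qed.

Lemma circulant_const x (a : R) :
  circulant x *m (const_mx a : 'cV_n) = (\sum_(i < n) x 0 i) *: const_mx a.
Proof.
apply/matrixP => j i; rewrite !mxE mulr_suml.
rewrite [RHS](reindex_inj (ord_diff_injl j)).
by apply: eq_bigr => k _; rewrite !mxE.
Qed.

Lemma spectral_norm_circulant x :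
  (forall t, t ^+ n = 1 -> `|symbol x t| <= `|symbol x 1|) ->
  spectral_norm (circulant x) = `|\sum_(i < n) x 0 i|.
Proof.
move=> le_symbol; rewrite /spectral_norm; set S := (X in sup X).
have S_ub : ubound S `|\sum_(i < n) x 0 i|.
  move=> _ [v v1 <-]; rewrite -[leRHS]mulr1 -[in leRHS]v1.
  exact: enorm_circulant_le.
have S_max : S `|\sum_(i < n) x 0 i|.
  (* The normalized constant vector is the eigenvector of eigenvalue [c(1)]. *)
  pose v0 : 'cV[R]_n := const_mx (Num.sqrt n%:R)^-1.
  have v0_1 : enorm v0 = 1.
    rewrite /enorm; under eq_bigr do rewrite mxE.
    rewrite sumr_const card_ord exprVn sqr_sqrtr ?ler0n //.
    by rewrite -[_^-1 *+ n]mulr_natr mulVf ?sqrtr1 // pnatr_eq0 -lt0n.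
  by exists v0 => //; rewrite circulant_const enormZ v0_1 mulr1.
apply/eqP; rewrite eq_le; apply/andP; split.
  by apply: ge_sup => //; exists `|\sum_(i < n) x 0 i|.
by apply: ub_le_sup => //; exists `|\sum_(i < n) x 0 i|.
Qed.

(** * Dominance and positivity *)

Definition dominant x : Prop :=
  forall t, t ^+ n = 1 -> t != 1 -> `|symbol x t| < `|symbol x 1|.

Hypothesis n_ge2 : (2 <= n)%N.

Lemma exists_nontrivial_unity_root : exists2 t : C, t ^+ n = 1 & t != 1.
Proof.
have [z pz] := exists_primitive_root C n n_gt0; exists z.
  exact: prim_expr_order.
by rewrite -[z]expr1 -[1](expr0 z) (eq_prim_root_expr pz) !modn_small.
Qed.

(** There are finitely many roots of unity, so strict dominance leaves a uniform
    gap below [|c(1)|]. *)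
Lemma dominant_gap x : dominant x ->
  exists q, [/\ 0 <= q, q < normc (symbol x 1) &
    forall t, t ^+ n = 1 -> t != 1 -> normc (symbol x t) <= q].
Proof.
move=> dom; have [z pz] := exists_primitive_root C n n_gt0.
exists (\big[Num.max/0]_(l < n | z ^+ l != 1) normc (symbol x (z ^+ l))); split.
- exact: bigmax_ge_id.
- apply: bigmax_lt => [|l zl_neq1].
    (* [c(1)] is nonzero because it dominates some [c(t)]: this uses [2 <= n]. *)
    have [t tn1 t_neq1] := exists_nontrivial_unity_root.
    by rewrite -ltcR -norm_normc (le_lt_trans (normr_ge0 (symbol x t))) ?dom.
  by rewrite -ltcR -!norm_normc dom // (prim_root_unity _ _ _ l pz).
- move=> t tn1 t_neq1; have [l tE] := prim_rootP pz tn1.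
  by rewrite tE; apply: (le_bigmax_cond _ (j := l)); rewrite -tE.
Qed.

(** Bounds the values of the symbol, without which their supremum would carry no
    information on each of them. *)
Lemma norm_symbol_le y t :
  t ^+ n = 1 -> normc (symbol y t) <= \sum_(i < n) `|y 0 i|.
Proof.
move=> tn1; rewrite -lecR -norm_normc (le_trans (ler_norm_sum _ _ _)) //.
rewrite rmorph_sum; apply: ler_sum => i _.
rewrite normrM normrX (norm_unity_root _ _ _ n_gt0 tn1) expr1n mulr1.
by rewrite normc_def /= expr0n addr0 sqrtr_sqr.
Qed.

(** The norm condition in [Cset'] follows from the bound on the nontrivial
    characters, by [spectral_norm_circulant]. *)
Lemma dominant_Cset' x : dominant x <-> x \in @Cset' R n.
Proof.
rewrite inE /Cset' /=; set S := (X in sup X).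
split=> [dom | [_ sup_lt] t tn1 /eqP t_neq1].
  split.
    apply: spectral_norm_circulant => t tn1.
    by have [->|/(dom _ tn1)/ltW] := eqVneq t 1.
  have [q [_ q_lt le_q]] := dominant_gap x dom.
  apply: le_lt_trans q_lt; apply: ge_sup.
    have [t tn1 /eqP t_neq1] := exists_nontrivial_unity_root.
    by exists (normc (symbol x t)), t.
  by move=> _ [t [tn1 /eqP t_neq1] <-]; apply: le_q.
rewrite !norm_normc ltcR (le_lt_trans _ sup_lt) //.
apply: ub_le_sup; last by exists t.
by exists (\sum_(i < n) `|x 0 i|) => _ [u [un1 _] <-]; apply: norm_symbol_le.
Qed.

(** Each row of [B^m], as a functional on the Fourier vectors, takes the value
    [|c(t)|^(2m)] up to a phase; its coefficients being positive, the strict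
    triangle inequality compares [t] with 1. *)
Lemma dominant_gram_exp_pos x m : mx_pos (gram x ^+ m) -> dominant x.
Proof.
move=> B_pos t tn1 t_neq1; pose j0 : 'I_n := Ordinal n_gt0.
have rowE u : u ^+ n = 1 ->
    \sum_(k < n) ((gram x ^+ m) j0 k)%:C%C * u ^+ k = `|symbol x u| ^+ (2 * m).
  move=> un1; have /matrixP/(_ j0 0) := gram_exp_fourier x u m un1.
  by rewrite !mxE mulr1 => <-; apply: eq_bigr => k _; rewrite !mxE.
have row_gt0 k : 0 < ((gram x ^+ m) j0 k)%:C%C by rewrite ltcR B_pos.
have := norm_sum_unity_root_lt C n _ t n_ge2 row_gt0
  (norm_unity_root _ _ _ n_gt0 tn1) t_neq1.
rewrite rowE // normrX normr_id; have := rowE 1 (expr1n _ _).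
under eq_bigr do rewrite expr1n mulr1.
move=> -> pow_lt; rewrite real_ltNge ?normr_real //; apply/negP => le_t.
have : `|symbol x 1| ^+ (2 * m) <= `|symbol x t| ^+ (2 * m).
  by apply: lerXn2r; rewrite ?nnegrE.
by rewrite (lt_geF pow_lt).
Qed.

(** In the inversion formula for the entries of [B^m], the trivial character
    contributes [|c(1)|^(2m)] and the remaining terms have moduli at most
    [q^(2m)] with [q < |c(1)|], hence a total smaller than [|c(1)|^(2m)] once
    [n q^(2m) < |c(1)|^(2m)]. *)
Lemma gram_exp_pos x : dominant x ->
  exists m0, (1 <= m0)%N /\ forall m, (m0 <= m)%N -> mx_pos (gram x ^+ m).
Proof.
move=> dom; have [z pz] := exists_primitive_root C n n_gt0.
have [q [q_ge0 q_lt le_q]] := dominant_gap x dom; set s := normc _ in q_lt.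
have q2_lt : q ^+ 2 < s ^+ 2 by rewrite ltrXn2r.
have [m0 m0P] := pow_dominates R (s ^+ 2) (q ^+ 2) n%:R (sqr_ge0 q) q2_lt.
exists (maxn 1 m0); split=> [|m]; first exact: leq_maxl.
rewrite geq_max => /andP[_ /m0P]; rewrite -!exprM => small j k.
pose term (l : 'I_n) :=
  `|symbol x (z ^+ l)| ^+ (2 * m) * ((z ^+ l) ^+ j * (z ^+ l) ^- k).
have inv : n%:R * toC ((gram x ^+ m) j k) = \sum_(l < n) term l.
  apply: (fourier_inversion _ (fun t => `|symbol x t| ^+ (2 * m)) z pz).
  by move=> t tn1; exact: gram_exp_fourier.
have term_le (l : 'I_n) : l != Ordinal n_gt0 -> `|term l| <= toC (q ^+ (2 * m)).
  move=> l_neq0; have zl_neq1 : z ^+ l != 1.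
    by rewrite -[1](expr0 z) (eq_prim_root_expr pz) !modn_small.
  rewrite /term normrM normrX normr_id normrM normfV !normrX.
  have -> : `|z| = 1 by apply: (norm_unity_root _ n) => //; exact: prim_expr_order.
  rewrite !expr1n invr1 !mulr1 norm_normc -rmorphXn lecR.
  by apply: lerXn2r; rewrite ?nnegrE ?normc_ge0 ?le_q ?(prim_root_unity _ _ _ l pz) //.
rewrite (bigD1 (Ordinal n_gt0)) //= in inv.
have term0 : term (Ordinal n_gt0) = toC (s ^+ (2 * m)).
  by rewrite /term expr0 !expr1n invr1 !mulr1 norm_normc -rmorphXn.
rewrite {}term0 in inv; set E := \sum_(l < n | _) _ in inv.
have E_lt : `|E| < toC (s ^+ (2 * m)).
  apply: le_lt_trans (ler_norm_sum _ _ _) _.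
  apply: le_lt_trans (ler_sum _ term_le) _.
  apply: (@le_lt_trans _ _ (\sum_(l < n) toC (q ^+ (2 * m)))).
    by rewrite [leRHS](bigD1 (Ordinal n_gt0)) //= lerDr lecR exprn_ge0.
  by rewrite sumr_const card_ord -rmorphMn ltcR -mulr_natl.
(* Only real numbers are comparable in [C]: [E] is real as a difference of the
   entry, which is real, and of the dominant term. *)
have E_real : E \is Num.real.
  have -> : E = toC (n%:R * (gram x ^+ m) j k - s ^+ (2 * m)).
    by rewrite rmorphB rmorphM /= rmorph_nat inv addrAC subrr add0r.
  by rewrite realE !lecR -realE num_real.
rewrite -ltcR -(@pmulr_rgt0 _ n%:R) ?ltr0n // inv addrC -ltrBlDr sub0r.
exact: real_ltrNnormlW.
Qed.

End Circulant.

Theorem corollary2p4 (R : realType) (n : nat) (hn : (2 <= n)%N) (x : 'rV[R]_n) :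
  let B := (circulant x)^T *m circulant x in
  [<-> x \in @Cset' R n;
       exists m : nat, (1 <= m)%N /\ mx_pos (B ^+ m);
       exists m0 : nat, (1 <= m0)%N /\
         forall m : nat, (m0 <= m)%N -> mx_pos (B ^+ m)].
Proof.
have n_gt0 : (0 < n)%N := ltnW hn.
move=> B; tfae.
- move/(dominant_Cset' _ _ n_gt0 hn)/(gram_exp_pos _ _ n_gt0 hn).
  case=> m0 [m0_gt0 B_pos].
  by exists m0; split=> //; apply: B_pos.
- by case=> m [_ /(dominant_gram_exp_pos _ _ n_gt0 hn)]; apply: gram_exp_pos.
- move=> [m0 [_ B_pos]]; apply/(dominant_Cset' _ _ n_gt0 hn).
  exact: dominant_gram_exp_pos (B_pos m0 (leqnn m0)).
Qed.
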